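(* Let $k\le l\le m\le n$ be positive integers, let $a,b\in\mathbb{R}$ be distinct, and let $\mathbb{U},\mathbb{W}\subseteq\mathbb{R}^n$ be subspaces of dimensions $k$ and $m$ respectively with $\mathbb{U}\subseteq\mathbb{W}$. Let $Q=[q_1,\dots,q_n]\in\mathrm{O}_n(\mathbb{R})$ be such that $\operatorname{span}\{q_1,\dots,q_k\}=\mathbb{U}$ and $\operatorname{span}\{q_{k+1},\dots,q_{k+n-m}\}=\mathbb{W}^\perp$. Let $A\in\mathsf{S}^2(\mathbb{R}^n)$ be such that \[ Q^{\mathsf T}AQ=\begin{bmatrix} B_{11} & B_{12} & B_{13} \\ {B_{12}^{\mathsf T}} & B_{22} & B_{23} \\ {B_{13}^{\mathsf T}} & {B_{23}^{\mathsf T}} & B_{33} \end{bmatrix} \] (blocks of sizes $k$, $n-m$, $m-k$) where $B_{33}\in\mathbb{R}^{(m-k)\times(m-k)}$ has distinct eigenvalues, and let $B_{33}=V\Lambda V^{\mathsf T}$, with $V\in\mathrm{O}_{m-k}(\mathbb{R})$ and $\Lambda$ diagonal, be an eigenvalue decomposition. Then $Y\in\Omega_{a,b}(\mathbb{U},\mathbb{W})$ is a stationary point of $\delta_A$ if and only if \[ Y=Q\begin{bmatrix} I_{n+k-m} & 0 \\ 0 & VP_\tau \end{bmatrix}\begin{bmatrix} aI_k & 0 & 0 & 0 \\ 0 & bI_{n-m} & 0 & 0 \\ 0 & 0 & aI_{l-k} & 0 \\ 0 & 0 & 0 & bI_{m-l} \end{bmatrix}\begin{bmatrix} I_{n+k-m}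 & 0 \\ 0 & P_\tau^{\mathsf T}V^{\mathsf T} \end{bmatrix}Q^{\mathsf T} \] for some $\tau\in\mathfrak{S}_{m-k}$, where $P_\tau$ is the permutation matrix associated with $\tau$. Moreover, $\delta_A:\Omega_{a,b}(\mathbb{U},\mathbb{W})^{\mathbb{C}}\to\mathbb{C}$ has $\binom{m-k}{l-k}$ distinct stationary points and they are all contained in $\Omega_{a,b}(\mathbb{U},\mathbb{W})$.
   Context: For $\mathbb{F}=\mathbb{R}$ or $\mathbb{C}$, $\mathsf{S}^2(\mathbb{F}^n)=\{X\in\mathbb{F}^{n\times n}: X^{\mathsf T}=X\}$ (transpose, not conjugate transpose); $\mathrm{O}_n(\mathbb{R})$ is the real orthogonal group; $\mathfrak{S}_r$ is the symmetric group. For integers $0\le r\le s$, $\operatorname{Gr}_{a,b}(r,s)=\{X\in \mathsf{S}^2(\mathbb{R}^s): (X-aI)(X-bI)=0,\ \operatorname{tr}(X)=ar+b(s-r)\}$, and $\operatorname{Gr}_{a,b}(r,s)^{\mathbb{C}}$ is the set of $X\in\mathsf{S}^2(\mathbb{C}^s)$ satisfying the same equations (for $s=0$ it consists of the empty matrix). Quadratic model of the Schubert variety of $l$-dimensional subspaces between $\mathbb{U}$ and $\mathbb{W}$: \[ \Omega_{a,b}(\mathbb{U},\mathbb{W})=\left\{Q\begin{bmatrix} aI_k & 0 & 0 \\ 0 & bI_{n-m} & 0 \\ 0 & 0 & X \end{bmatrix}Q^{\mathsf T}: X\in\operatorname{Gr}_{a,b}(l-k,m-k)\right\}\subseteq\mathsf{S}^2(\mathbb{R}^n),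 \] and its complex locus $\Omega_{a,b}(\mathbb{U},\mathbb{W})^{\mathbb{C}}\subseteq\mathsf{S}^2(\mathbb{C}^n)$ is given by the same block form with $X\in\operatorname{Gr}_{a,b}(l-k,m-k)^{\mathbb{C}}$. Both are smooth. The Euclidean distance function is $\delta_A(Y)=\tfrac12\sum_{i,j}(y_{ij}-a_{ij})^2$ (no absolute values). A point $Y$ of $\mathcal{M}=\Omega_{a,b}(\mathbb{U},\mathbb{W})$ (resp. $\mathcal{M}=\Omega_{a,b}(\mathbb{U},\mathbb{W})^{\mathbb{C}}$) is a stationary point of $\delta_A$ on $\mathcal{M}$ if $\operatorname{tr}(Z^{\mathsf T}(Y-A))=0$ for every $Z\in\mathbb{T}_Y\mathcal{M}$. *)

(* Defs.v *)
From HB Require Import structures.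
From mathcomp Require Import all_boot all_order all_algebra all_fingroup.
From mathcomp Require Import all_classical all_reals all_analysis.
From mathcomp Require Import complex.

Set Implicit Arguments.
Unset Strict Implicit.
Unset Printing Implicit Defensive.

Import Order.TTheory GRing.Theory Num.Theory.
Import numFieldNormedType.Exports.

Local Open Scope classical_set_scope.
Local Open Scope ring_scope.

Lemma sum_blocks k l m n : (k <= l)%N -> (l <= m)%N -> (m <= n)%N ->
  (k + (n - m) + (m - k))%N = n.
Proof.
move=> hkl hlm hmn.
by rewrite addnAC (subnKC (leq_trans hkl hlm)) subnKC.
Qed.

Lemma sum_inner k l m : (k <= l)%N -> (l <= m)%N ->
  ((l - k) + (m - l))%N = (m - k)%N.
Proof. by move=> hkl hlm; rewrite addnC addnBA // subnK. Qed.

Definition orthogonalmx (F : fieldType) n (Q : 'M[F]_n) : Prop :=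
  Q^T *m Q = 1%:M.

(* Linear span of the columns q_{i+1}, ..., q_j of Q (1-based numbering). *)
Definition colspan (F : fieldType) n (Q : 'M[F]_n) (i j : nat) :
    {vspace 'cV[F]_n} :=
  <<[seq col c Q | c : 'I_n <- enum 'I_n & (i <= c < j)%N]>>%VS.

Definition orthcompl (F : fieldType) n (W : {vspace 'cV[F]_n}) :
    set 'cV[F]_n :=
  [set v | forall w, w \in W -> w^T *m v = 0].

Definition distinct_eigenvalues (F : fieldType) n (B : 'M[F]_n) : Prop :=
  exists s : n.-tuple F, uniq s /\ all (eigenvalue B) s.

(* F is R for the real locus and R[i] for the complex locus; transposes are
   never conjugated. *)
Definition Gr (F : fieldType) (a b : F) (r s : nat) : set 'M[F]_s :=
  [set X | [/\ X^T = X, (X - a%:M) *m (X - b%:M) = 0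
             & \tr X = a *+ r + b *+ (s - r)]].
Arguments Gr {F} a b r s _.

Section Blocks.
Variables (F : fieldType) (k l m n : nat).
Variables (hkl : (k <= l)%N) (hlm : (l <= m)%N) (hmn : (m <= n)%N).

(* Transports a matrix with row and column blocks of sizes k, n - m, m - k
   to size n. *)
Definition of_blocks (M : 'M[F]_(k + (n - m) + (m - k))) : 'M[F]_n :=
  castmx (sum_blocks hkl hlm hmn, sum_blocks hkl hlm hmn) M.

Definition block_abX (a b : F) (X : 'M[F]_(m - k)) : 'M[F]_n :=
  of_blocks (block_mx (block_mx a%:M 0 0 b%:M) 0 0 X).

Definition block_1X (X : 'M[F]_(m - k)) : 'M[F]_n :=
  of_blocks (block_mx 1%:M 0 0 X).

Definition block_ab (a b : F) : 'M[F]_(m - k) :=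
  castmx (sum_inner hkl hlm, sum_inner hkl hlm)
    (block_mx (a%:M : 'M[F]_(l - k)) 0 0 (b%:M : 'M[F]_(m - l))).

Definition Omega (a b : F) (Q : 'M[F]_n) : set 'M[F]_n :=
  [set Q *m block_abX a b X *m Q^T | X in Gr a b (l - k)%N (m - k)%N].

End Blocks.

(* Velocities at Y of the curves of M through Y. For F = R[i], [derivable] is
   complex differentiability, so the curves are holomorphic near 0 and this is
   the holomorphic tangent space. *)
Definition tangent_space (F : numFieldType) n (M : set 'M[F]_n) (Y : 'M[F]_n) :
    set 'M[F]_n :=
  [set Z | exists g : F -> 'M[F]_n,
     [/\ \forall t \near (0 : F), M (g t),
         \forall t \near (0 : F), derivable g t 1,
         g 0 = Y
       & is_derive (0 : F) 1 g Z]].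

(* Stationarity of Y |-> 1/2 * \sum_(i, j) (Y i j - A i j) ^+ 2 on M: its
   differential at Y is Z |-> \tr (Z^T *m (Y - A)). *)
Definition dist_stationary (F : numFieldType) n (M : set 'M[F]_n)
    (A : 'M[F]_n) : set 'M[F]_n :=
  [set Y | M Y /\
     forall Z, tangent_space M Y Z -> \tr (Z^T *m (Y - A)) = 0].

Definition cplx (R : realType) (x : R) : R[i] := real_complex R x.

Definition cplxmx (R : realType) n (M : 'M[R]_n) : 'M[R[i]]_n :=
  map_mx (@cplx R) M.

(* Main.v *)
Require Import Defs.
From mathcomp Require Import all_boot all_order all_algebra all_fingroup.
From mathcomp Require Import all_classical all_reals all_analysis.
From mathcomp Require Import finmap complex ring.

Set Implicit Arguments.
Unset Strict Implicit.
Unset Printing Implicit Defensive.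

Import Order.TTheory GRing.Theory Num.Theory.
Import numFieldNormedType.Exports.

Local Open Scope classical_set_scope.
Local Open Scope card_scope.
Local Open Scope ring_scope.

(** Let J be the inclusion of the last m - k coordinates and G = Q J, so that
    G^T G = 1 and Omega is the affine image of Gr under X |-> c + G X G^T with
    G^T c = 0. A tangent vector is G Z G^T, where differentiating
    X^2 = (a + b) X - ab gives Z X + X Z = (a + b) Z, and stationarity becomes
    tr ((X - B33) Z) = 0. If X commutes with B33 this trace vanishes, since
    (a - b)^2 tr (N Z) = 0 for every N commuting with X. Conversely, conjugating
    X by rotations in the (i, j)-plane shows that the entries of
    B33 X - X B33 vanish. As B33 = V Lam V^T has simple spectrum, V^T X V is then
    diagonal with entries a and b, and the trace condition says that a occurs
    l - k times. The rotations are parametrised rationally, so the argument is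
    the same over R and R[i]. *)

(** * Entrywise differentiation of matrix-valued curves *)

(* The library's derivable_mxP and derive_mx need a realFieldType, which excludes
   R[i]; this entrywise notion serves both fields. *)
Definition entrywise_derive (F : numFieldType) m n (f : F -> 'M[F]_(m, n))
    (t : F) (df : 'M[F]_(m, n)) : Prop :=
  forall i j, is_derive t 1 (fun x => f x i j) (df i j).

Lemma is_derive_entrywise (F : numFieldType) m n (f : F -> 'M[F]_(m, n))
  (t : F) (df : 'M[F]_(m, n)) :
  is_derive t 1 f df -> entrywise_derive f t df.
Proof.
case=> fd fv i j.
have cv : (h^-1 *: (f (h *: 1 + t) i j - f t i j)) @[h --> (0 : F)^'] --> df i j.
  have -> : (fun h : F => h^-1 *: (f (h *: 1 + t) i j - f t i j)) =
      (fun M : 'M[F]_(m, n) => M i j) \o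
      (fun h : F => h^-1 *: (f (h *: 1 + t) - f t)).
    by apply/funext => h /=; rewrite !mxE.
  apply: continuous_cvg; first exact: coord_continuous.
  by rewrite -fv; exact: fd.
apply: DeriveDef; first by apply/cvg_ex; exists (df i j).
exact: cvg_lim.
Qed.

Lemma entrywise_derive_cst (F : numFieldType) m n (M : 'M[F]_(m, n)) (t : F) :
  entrywise_derive (fun=> M) t 0.
Proof. by move=> i j; rewrite mxE; exact: is_derive_cst. Qed.

Lemma entrywise_deriveB (F : numFieldType) m n (f g : F -> 'M[F]_(m, n))
  (t : F) (df dg : 'M[F]_(m, n)) :
  entrywise_derive f t df -> entrywise_derive g t dg ->
  entrywise_derive (fun x => f x - g x) t (df - dg).
Proof.
move=> hf hg i j; rewrite !mxE.
have -> : (fun x => (f x - g x) i j) = (fun x => f x i j) - (fun x => g x i j).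
  by apply/funext => x; rewrite !mxE.
exact: is_deriveB.
Qed.

Lemma entrywise_deriveM (F : numFieldType) m n p (f : F -> 'M[F]_(m, n))
  (g : F -> 'M[F]_(n, p)) (t : F) (df : 'M[F]_(m, n)) (dg : 'M[F]_(n, p)) :
  entrywise_derive f t df -> entrywise_derive g t dg ->
  entrywise_derive (fun x => f x *m g x) t (df *m g t + f t *m dg).
Proof.
move=> hf hg i j.
have -> : (fun x => (f x *m g x) i j) =
    \sum_(k < n) ((fun x => f x i k) * (fun x => g x k j)).
  by apply/funext => x; rewrite !mxE fct_sumE.
apply: (@is_derive_eq _ _ _ _ _ _ _ _ (is_derive_sum (fun k =>
  is_deriveM (hf i k) (hg k j)))).
rewrite !mxE -big_split /=; apply: eq_bigr => k _.
by rewrite addrC; congr (_ + _); exact: mulrC.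
Qed.

(** Derivatives are local, so an identity valid only near [t] may be differentiated. Curves defining
    a tangent space lie on the set only near 0, hence this form. *)
Lemma entrywise_derive_unique (F : numFieldType) m n (f g : F -> 'M[F]_(m, n))
  (t : F) (df dg : 'M[F]_(m, n)) :
  (\near t, f t = g t) ->
  entrywise_derive f t df -> entrywise_derive g t dg -> df = dg.
Proof.
move=> fg hf hg; apply/matrixP => i j.
have fg' : \near t, f t i j = g t i j by apply: filterS fg => x ->.
have [_ <-] := near_eq_is_derive fg' (hf i j).
by have [_ <-] := hg i j.
Qed.

Lemma is_derive_scalel (F : numFieldType) m n (f : F -> F) (C : 'M[F]_(m, n))
  (t df : F) :
  is_derive t 1 f df -> is_derive t 1 (fun x => f x *: C) (df *: C).
Proof.
case=> fd fv.
have cv : (h^-1 *: (f (h *: 1 + t) *: C - f t *: C)) @[h --> (0 : F)^']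
    --> df *: C.
  have -> : (fun h : F => h^-1 *: (f (h *: 1 + t) *: C - f t *: C)) =
      (fun h : F => (h^-1 *: (f (h *: 1 + t) - f t)) *: C).
    by apply/funext => h /=; rewrite -scalerBl scalerA.
  by apply: cvgZr_tmp; rewrite -fv; exact: fd.
apply: DeriveDef; first by apply/cvg_ex; exists (df *: C).
exact: cvg_lim.
Qed.

(** * The equations of [Gr] and of its tangent vectors *)

Lemma orthogonal_conjK (F : fieldType) n s (G : 'M[F]_(n, s)) (X : 'M[F]_s) :
  G^T *m G = 1%:M -> G^T *m (G *m X *m G^T) *m G = X.
Proof. by move=> GG; rewrite !mulmxA GG mul1mx -mulmxA GG mulmx1. Qed.

Lemma Gr_sqr (F : fieldType) (a b : F) r s (X : 'M[F]_s) :
  Gr a b r s X -> X *m X = (a + b) *: X - (a * b)%:M.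
Proof.
case=> _ + _; rewrite mulmxBl !mulmxBr mul_mx_scalar !mul_scalar_mx => h.
apply/eqP; rewrite -subr_eq0 -{}h scale_scalar_mx; apply/eqP.
by apply/matrixP => i j; rewrite !mxE; ring.
Qed.

(** Pairing the relation for [Z] with any M that commutes with [X] gives 2 tr(MXZ) = (a + b) tr(MZ).
    Taking M = N and M = NX, and reducing X^2, yields (a - b)^2 tr(NZ) = 0. *)
Lemma mxtrace_anticommuting (F : numFieldType) s (a b : F) (X Z N : 'M[F]_s) :
  a != b -> X *m X = (a + b) *: X - (a * b)%:M ->
  Z *m X + X *m Z = (a + b) *: Z -> X *m N = N *m X -> \tr (N *m Z) = 0.
Proof.
move=> ab XX ZX XN.
have tr2 M : X *m M = M *m X -> 2 * \tr (M *m X *m Z) = (a + b) * \tr (M *m Z).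
  move=> XM.
  have -> : (a + b) * \tr (M *m Z) = \tr (M *m (Z *m X + X *m Z)).
    by rewrite ZX -scalemxAr mxtraceZ.
  rewrite mulmxDr mxtraceD !mulmxA.
  by rewrite [\tr (M *m Z *m X)]mxtrace_mulC mulmxA XM mulr_natl.
have h1 := tr2 _ XN.
have := tr2 (N *m X); rewrite mulmxA XN => /(_ erefl).
rewrite -(mulmxA N X X) XX mulmxBr -scalemxAr mul_mx_scalar mulmxBl -!scalemxAl.
rewrite linearB /= !mxtraceZ => h2.
apply/eqP; have : (a - b) ^+ 2 * \tr (N *m Z) == 0.
  have h3 : (a + b) * \tr (N *m X *m Z) = 2 * (a * b) * \tr (N *m Z).
    apply/eqP; rewrite -subr_eq0; apply/eqP.
    by rewrite -[RHS](subrr ((a + b) * \tr (N *m X *m Z))) -{2}h2; ring.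
  apply/eqP; rewrite -[RHS](subrr (2 * ((a + b) * \tr (N *m X *m Z)))) {2}h3.
  by rewrite mulrCA h1; ring.
by rewrite mulf_eq0 sqrf_eq0 subr_eq0 (negbTE ab).
Qed.

(** With [c] and [G] abstract, the differential arguments stay free of block casts; [OmegaE] puts
    [Omega] in this form. *)
Definition affine_Gr (F : fieldType) (a b : F) r n s (c : 'M[F]_n)
    (G : 'M[F]_(n, s)) : set 'M[F]_n :=
  [set c + G *m X *m G^T | X in Gr a b r s].

Lemma affine_Gr_tangent (F : numFieldType) (a b : F) r n s (c : 'M[F]_n)
  (G : 'M[F]_(n, s)) (X : 'M[F]_s) (Z : 'M[F]_n) :
  G^T *m G = 1%:M ->
  tangent_space (affine_Gr a b r c G) (c + G *m X *m G^T) Z ->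
  let Z' := G^T *m Z *m G in
  Z = G *m Z' *m G^T /\ Z' *m X + X *m Z' = (a + b) *: Z'.
Proof.
move=> GG [g [Mg _ g0 dg]] /=.
(* As G^T G = 1, compression by [G] recovers from [g] the underlying curve in [Gr]. *)
pose h t := G^T *m (g t - c) *m G.
have h0 : h 0 = X by rewrite /h g0 addrAC subrr add0r orthogonal_conjK.
have dh : entrywise_derive h 0 (G^T *m Z *m G).
  have := entrywise_deriveM (entrywise_deriveM (entrywise_derive_cst G^T 0)
    (entrywise_deriveB (is_derive_entrywise dg) (entrywise_derive_cst c 0)))
    (entrywise_derive_cst G 0).
  by rewrite !mul0mx add0r mulmx0 addr0 subr0.
have near_h : \forall t \near (0 : F),
    Gr a b r s (h t) /\ g t = c + G *m h t *m G^T.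
  by apply: filterS Mg => t [Y GY e]; rewrite /h -e addrAC subrr add0r orthogonal_conjK.
(* The first claim differentiates g - c = G h G^T, the second h^2 = (a + b) h - ab; both identities
   hold near 0. *)
split.
  apply: (@entrywise_derive_unique _ _ _ (fun t => g t - c)
    (fun t => G *m h t *m G^T) 0).
  - by apply: filterS near_h => t [_ ->]; rewrite addrAC subrr add0r.
  - rewrite -[X in entrywise_derive _ _ X]subr0.
    apply: entrywise_deriveB; first exact: is_derive_entrywise.
    exact: entrywise_derive_cst.
  - have := entrywise_deriveM (entrywise_deriveM (entrywise_derive_cst G 0) dh)
      (entrywise_derive_cst G^T 0).
    by rewrite mul0mx add0r mulmx0 addr0.
rewrite -h0.
apply: (@entrywise_derive_unique _ _ _ (fun t => h t *m h t)
  (fun t => (a + b)%:M *m h t - (a * b)%:M) 0).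
- apply: filterS near_h => t [/Gr_sqr -> _]; by rewrite mul_scalar_mx.
- exact: entrywise_deriveM.
- rewrite -[X in entrywise_derive _ _ X]subr0.
  apply: entrywise_deriveB; last exact: entrywise_derive_cst.
  have := entrywise_deriveM (entrywise_derive_cst (a + b)%:M 0) dh.
  by rewrite mul0mx add0r mul_scalar_mx.
Qed.

(** * Conjugation by plane rotations *)

Lemma Gr_conj (F : fieldType) (a b : F) r s (X V : 'M[F]_s) :
  V^T *m V = 1%:M -> Gr a b r s X -> Gr a b r s (V *m X *m V^T).
Proof.
move=> VV [XT Xab Xtr]; have VV' := mulmx1C VV.
split.
- by rewrite !trmx_mul trmxK XT mulmxA.
- have conjB d : V *m X *m V^T - d%:M = V *m (X - d%:M) *m V^T.
    by rewrite mulmxBr mulmxBl mul_mx_scalar -scalemxAl VV' scalemx1.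
  rewrite !conjB -!mulmxA (mulmxA V^T) VV mul1mx (mulmxA (X - a%:M)) Xab.
  by rewrite mul0mx mulmx0.
- by rewrite mxtrace_mulC mulmxA VV mul1mx.
Qed.

Lemma rotation_trmx (F : fieldType) s (S : 'M[F]_s) (p q : F) :
  S^T = - S ->
  (1%:M + p *: S + q *: (S *m S))^T = 1%:M - p *: S + q *: (S *m S).
Proof.
move=> ST; rewrite !linearD !linearZ /= trmx1 trmx_mul ST mulmxN mulNmx opprK.
by rewrite scalerN.
Qed.

(** Rodrigues' formula: if S^3 = -S, then exp(xS) = 1 + sin x S + (1 - cos x) S^2. With p = sin x
    and q = 1 - cos x, the relation between [p] and [q] is sin^2 + cos^2 = 1. *)
Lemma rotation_orthogonal (F : fieldType) s (S : 'M[F]_s) (p q : F) :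
  S^T = - S -> S *m S *m S = - S -> p * p = 2 * q - q * q ->
  let R := 1%:M + p *: S + q *: (S *m S) in R^T *m R = 1%:M.
Proof.
move=> ST S3 pq /=.
rewrite rotation_trmx //.
have S4 : S *m S *m (S *m S) = - (S *m S) by rewrite mulmxA S3 mulNmx.
rewrite !mulmxDl !mulmxDr !mul1mx !mulmx1 !mulNmx -!scalemxAl -!scalemxAr.
rewrite S4 S3 !mulmxA S3.
rewrite [RHS](_ : _ = 1%:M + (2 * q - q * q - p * p) *: (S *m S)).
  by move: (S *m S) => T; apply/matrixP => i j; rewrite !mxE; ring.
by rewrite pq subrr scale0r addr0.
Qed.

(** Collecting by monomials in [p] and [q] gives the shape that [is_derive_quadratic]
    differentiates. *)
Lemma rotation_conj (F : fieldType) s (S X : 'M[F]_s) (p q : F) :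
  S^T = - S ->
  let T := S *m S in let R := 1%:M + p *: S + q *: T in
  R *m X *m R^T = X + p *: (S *m X - X *m S) + q *: (T *m X + X *m T)
    + (p * p) *: - (S *m X *m S) + (p * q) *: (S *m X *m T - T *m X *m S)
    + (q * q) *: (T *m X *m T).
Proof.
move=> ST /=.
rewrite rotation_trmx //.
move: (S *m S) => T.
rewrite !mulmxDl !mulmxDr !mul1mx !mulmx1 !mulmxN -!scalemxAl -!scalemxAr.
rewrite -?scalemxAl.
move: (S *m X *m S) (S *m X *m T) (T *m X *m S) (T *m X *m T) => C1 C2 C3 C4.
move: (S *m X) (X *m S) (T *m X) (X *m T) => D1 D2 D3 D4.
by apply/matrixP => i j; rewrite !mxE; ring.
Qed.

(** S^2 is minus the projection onto the (i, j)-coordinate plane, which contains the image of S;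
    hence S^3 = -S. *)
Lemma plane_rotation_generator (F : fieldType) s (i j : 'I_s) :
  i != j -> let S : 'M[F]_s := delta_mx i j - delta_mx j i in
  S^T = - S /\ S *m S *m S = - S.
Proof.
move=> ij /=; have ji : j != i by rewrite eq_sym.
split; first by rewrite linearB /= !trmx_delta opprB.
have -> : (delta_mx i j - delta_mx j i) *m (delta_mx i j - delta_mx j i) =
    - (delta_mx i i + delta_mx j j) :> 'M[F]_s.
  rewrite mulmxBl !mulmxBr !mul_delta_mx_cond !eqxx (negbTE ij) (negbTE ji).
  by rewrite !mulr0n !mulr1n sub0r subr0 opprD.
rewrite mulNmx mulmxDl !mulmxBr !mul_delta_mx_cond !eqxx (negbTE ij).
by rewrite (negbTE ji) !mulr0n !mulr1n sub0r subr0.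
Qed.

Lemma is_derive_quadratic (F : numFieldType) m n (p q : F -> F) (t dp dq : F)
  (C0 C1 C2 C3 C4 C5 : 'M[F]_(m, n)) :
  is_derive t 1 p dp -> is_derive t 1 q dq ->
  is_derive t 1 (fun x => C0 + p x *: C1 + q x *: C2 + (p x * p x) *: C3
      + (p x * q x) *: C4 + (q x * q x) *: C5)
    (dp *: C1 + dq *: C2 + (2 * p t * dp) *: C3
      + (p t * dq + q t * dp) *: C4 + (2 * q t * dq) *: C5).
Proof.
move=> hp hq.
have hM (f g : F -> F) df dg (C : 'M[F]_(m, n)) :
    is_derive t 1 f df -> is_derive t 1 g dg ->
    is_derive t 1 (fun x => (f x * g x) *: C) ((f t * dg + g t * df) *: C).
  by move=> hf hg; apply: (is_derive_scalel C (is_deriveM hf hg)).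
have := is_deriveD (is_deriveD (is_deriveD (is_deriveD (is_deriveD
  (is_derive_cst C0 t 1) (is_derive_scalel C1 hp)) (is_derive_scalel C2 hq))
  (hM _ _ _ _ C3 hp hp)) (hM _ _ _ _ C4 hp hq)) (hM _ _ _ _ C5 hq hq).
move=> h; apply: (@is_derive_eq _ _ _ _ _ _ _ _ h).
by apply/matrixP => i j; rewrite !mxE; ring.
Qed.

(** Conjugating X by rotations generated by S stays in [Gr]. At t = 0 one has p = q = 0, p' = 2 and
    q' = 0, so only the commutator term survives, with factor 2. *)
Lemma tangent_rotation (F : numFieldType) (a b : F) r n s (c : 'M[F]_n)
  (G : 'M[F]_(n, s)) (X S : 'M[F]_s) :
  Gr a b r s X -> S^T = - S -> S *m S *m S = - S ->
  tangent_space (affine_Gr a b r c G) (c + G *m X *m G^T)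
    (G *m (2 *: (S *m X - X *m S)) *m G^T).
Proof.
move=> GX ST S3; pose u (t : F) := (1 + t * t)^-1.
(* sin x and 1 - cos x, in terms of t = tan (x / 2) *)
pose p t := (2 * t) * u t; pose q t := t * p t.
pose T := S *m S.
pose L (Y : 'M[F]_s) := G *m Y *m G^T.
have LD Y Y' : L (Y + Y') = L Y + L Y' by rewrite /L mulmxDr mulmxDl.
have LZ d Y : L (d *: Y) = d *: L Y by rewrite /L -scalemxAr -scalemxAl.
pose g t := c + L X + p t *: L (S *m X - X *m S) + q t *: L (T *m X + X *m T)
  + (p t * p t) *: L (- (S *m X *m S)) + (p t * q t) *: L (S *m X *m T - T *m X *m S)
  + (q t * q t) *: L (T *m X *m T).
pose R t := 1%:M + p t *: S + q t *: T.
have gE t : g t = c + L (R t *m X *m (R t)^T).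
  by rewrite /R (rotation_conj _ _ _ ST) /g -/T !(LD, LZ) !addrA.
(* Over R[i] the denominator does vanish, but only where |t| = 1, so the parametrisation is regular
   near 0. *)
have nz : \forall t \near (0 : F), 1 + t * t != 0.
  near=> t; apply/negP => /eqP h.
  have t1 : `|t| < 1 by near: t; exists 1 => //= x /=; rewrite sub0r normrN.
  have : `|t| * `|t| < 1 by rewrite mulr_ilt1.
  rewrite -normrM (_ : t * t = - 1) ?normrN1 ?ltxx //.
  by apply/eqP; rewrite -addr_eq0 addrC h.
have du t : 1 + t * t != 0 -> derivable u t 1.
  by move=> tn0; apply: (@derivableV _ _ (fun x : F => 1 + x * x)).
have d2 (t : F) : is_derive t 1 (fun t : F => 2 * t) 2.
  apply: (is_derive_eq (is_deriveM (is_derive_cst (2 : F) t 1)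
    (is_derive_id t (1 : F)))).
  by rewrite scaler0 addr0 /GRing.scale /= mulr1.
have dp t : 1 + t * t != 0 -> derivable p t 1.
  by move=> /du/derivableP tn0; case: (is_deriveM (d2 t) tn0).
have dq t : 1 + t * t != 0 -> derivable q t 1.
  by move=> /dp/derivableP tn0; case: (is_deriveM (is_derive_id t (1 : F)) tn0).
have n0 : 1 + 0 * 0 != 0 :> F by rewrite mul0r addr0 oner_neq0.
have p0 : p 0 = 0 by rewrite /p mulr0 mul0r.
have u0 : u 0 = 1 by rewrite /u mul0r addr0 invr1.
have dp0 : is_derive (0 : F) 1 p 2.
  apply: (is_derive_eq (is_deriveM (d2 0) (derivableP (du _ n0)))).
  by rewrite mulr0 scale0r add0r u0 scale1r.
have dq0 : is_derive (0 : F) 1 q 0.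
  apply: (is_derive_eq (is_deriveM (is_derive_id (0 : F) 1) dp0)).
  by rewrite p0 !scale0r addr0.
have g0 : g 0 = c + L X.
  by rewrite /g p0 /q p0 !mul0r !scale0r !addr0.
exists g; split => //.
- apply: filterS nz => t tn0; rewrite gE.
  exists (R t *m X *m (R t)^T) => //; apply: Gr_conj => //.
  apply: rotation_orthogonal => //.
  rewrite /q /p /u; apply/eqP; rewrite -subr_eq0; apply/eqP.
  by field.
- apply: filterS nz => t tn0.
  by case: (is_derive_quadratic (c + L X) (L (S *m X - X *m S))
    (L (T *m X + X *m T)) (L (- (S *m X *m S)))
    (L (S *m X *m T - T *m X *m S)) (L (T *m X *m T))
    (derivableP (dp t tn0)) (derivableP (dq t tn0))).
- apply: (is_derive_eq (is_derive_quadratic _ _ _ _ _ _ dp0 dq0)).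
  rewrite p0 /q p0 !(mulr0, mul0r, addr0, scale0r).
  exact/esym/LZ.
Unshelve. all: by end_near. Qed.

(** * Stationarity as commutation with the compressed matrix *)

Lemma mxtrace_deltal (F : fieldType) s (i j : 'I_s) (C : 'M[F]_s) :
  \tr (delta_mx i j *m C) = C j i.
Proof.
rewrite /mxtrace (bigD1 i) //= big1 ?addr0 => [|x xi]; rewrite mxE.
  rewrite (bigD1 j) //= big1 ?addr0 => [|y yj].
    by rewrite mxE !eqxx mul1r.
  by rewrite mxE (negbTE yj) andbF mul0r.
by rewrite big1 // => y _; rewrite mxE (negbTE xi) mul0r.
Qed.

Lemma affine_Gr_stationary (F : numFieldType) (a b : F) r n s (c A : 'M[F]_n)
  (G : 'M[F]_(n, s)) (X : 'M[F]_s) :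
  a != b -> G^T *m G = 1%:M -> G^T *m c = 0 -> A^T = A -> Gr a b r s X ->
  let B := G^T *m A *m G in
  dist_stationary (affine_Gr a b r c G) A (c + G *m X *m G^T) <->
  X *m B = B *m X.
Proof.
move=> ab GG Gc AT GX B.
have BT : B^T = B by rewrite /B !trmx_mul trmxK AT mulmxA.
have XT : X^T = X by case: GX.
have XX := Gr_sqr GX.
(* By cyclicity of the trace only the compression of Y - A by [G] matters, and G^T c = 0 removes the
   constant part from it. *)
have pairing Z : \tr ((G *m Z *m G^T)^T *m (c + G *m X *m G^T - A)) =
    \tr ((X - B) *m Z).
  rewrite !trmx_mul trmxK mxtrace_mulC !mulmxA mxtrace_mulC !mulmxA.
  have -> : G^T *m (c + G *m X *m G^T - A) *m G = X - B.
    rewrite mulmxBr mulmxDr mulmxBl mulmxDl !mulmxA Gc mul0mx add0r GG mul1mx.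
    by rewrite -(mulmxA X) GG mulmx1.
  by rewrite -mxtrace_tr trmx_mul trmxK linearB /= XT BT mxtrace_mulC.
clearbody B; split=> [[_ st] | XB].
  (* The commutator C = BX - XB is skew, so its diagonal vanishes; the (i, j) entry is isolated by
     testing against the rotation in the (i, j)-plane. *)
  suff C0 : B *m X - X *m B = 0 by apply/esym/eqP; rewrite -subr_eq0 C0.
  have CT : (B *m X - X *m B)^T = - (B *m X - X *m B).
    by rewrite linearB /= !trmx_mul XT BT opprB.
  have Csk x y : (B *m X - X *m B) y x = - (B *m X - X *m B) x y.
    by have := congr1 (fun M : 'M[F]_s => M x y) CT; rewrite !mxE.
  apply/matrixP => i j; rewrite [RHS]mxE.
  have [<-|ij] := eqVneq i j.
    by apply/eqP; rewrite -eqNr -Csk.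
  have [ST S3] := plane_rotation_generator F ij.
  set S := delta_mx i j - delta_mx j i in ST S3.
  have := st _ (tangent_rotation c G GX ST S3); rewrite pairing.
  rewrite -scalemxAr mxtraceZ => /eqP; rewrite mulf_eq0 pnatr_eq0 /=.
  (* Cyclicity gives tr((X - B)[S, X]) = tr(S [X, X - B]), and [X, X - B] = BX - XB. *)
  have -> : \tr ((X - B) *m (S *m X - X *m S)) = \tr (S *m (B *m X - X *m B)).
    have <- : X *m (X - B) - (X - B) *m X = B *m X - X *m B.
      by rewrite mulmxBr mulmxBl opprB addrCA addrAC subrr add0r.
    have trB (M N : 'M[F]_s) : \tr (M - N) = \tr M - \tr N by exact: linearB.
    rewrite [in LHS]mulmxBr [in RHS]mulmxBr !trB; congr (_ - _).
      by rewrite mulmxA mxtrace_mulC mulmxA mxtrace_mulC.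
    by rewrite mulmxA mxtrace_mulC.
  (* Here tr(SC) = C_ji - C_ij, which skewness turns into -2 C_ij. *)
  rewrite mulmxBl linearB /= !mxtrace_deltal Csk -opprD oppr_eq0.
  by rewrite -mulr2n mulrn_eq0 => /eqP.
split=> [|Z /(affine_Gr_tangent GG)]; first by exists X.
set Z' := G^T *m Z *m G => -[-> ZX].
(* The matrix N = X - B commutes with X because B does. *)
rewrite pairing; apply: (mxtrace_anticommuting ab XX ZX).
by rewrite mulmxBr mulmxBl XB.
Qed.

(** * Diagonal points of [Gr] and simple spectrum *)

(** Indexed by the set of positions of [a]: several permutations can give the same matrix, so
    subsets are what must be counted. *)
Definition two_valued (F : fieldType) s (a b : F) (S : {set 'I_s}) : 'M[F]_s :=
  diag_mx (\row_i (if i \in S then a else b)).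

Lemma two_valued_inj (F : fieldType) s (a b : F) :
  a != b -> injective (@two_valued F s a b).
Proof.
move=> ab S T /matrixP ST; apply/setP => i.
have := ST i i; rewrite !mxE !eqxx !mulr1n.
by do 2![case: ifP => _] => // /eqP; rewrite ?[b == a]eq_sym (negbTE ab).
Qed.

Lemma mxtrace_two_valued (F : fieldType) s (a b : F) (S : {set 'I_s}) :
  \tr (two_valued a b S) = a *+ #|S| + b *+ (s - #|S|).
Proof.
rewrite mxtrace_diag (eq_bigr (fun i => if i \in S then a else b)); last first.
  by move=> i _; rewrite mxE.
rewrite (bigID (mem S)) /= (eq_bigr (fun=> a)) => [|i ->] //.
rewrite [X in _ + X](eq_bigr (fun=> b)) => [|i /negbTE ->] //.
rewrite !sumr_const; congr (_ + _ *+ _).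
by have := cardC (mem S); rewrite card_ord => /(canRL (addKn _)).
Qed.

Lemma Gr_two_valued (F : fieldType) s (a b : F) (S : {set 'I_s}) :
  Gr a b #|S| s (two_valued a b S).
Proof.
split; [exact: tr_diag_mx| |exact: mxtrace_two_valued].
rewrite -!diag_const_mx -!linearB /= mulmx_diag.
apply/matrixP => i j; rewrite !mxE.
by case: ifP => _; rewrite subrr ?mul0r ?mulr0 mul0rn.
Qed.

(** The (i, j) entry of the commutation relation reads (d_j - d_i) D_ij = 0. *)
Lemma commuting_diag_mx (F : fieldType) s (d : 'rV[F]_s) (D : 'M[F]_s) :
  injective (d 0) -> D *m diag_mx d = diag_mx d *m D ->
  D = diag_mx (\row_i D i i).
Proof.
move=> dinj /matrixP comm; apply/matrixP => i j; rewrite !mxE.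
have [->|ij] := eqVneq i j; first by rewrite mulr1n.
have := comm i j; rewrite mul_mx_diag mul_diag_mx !mxE mulrC => /eqP.
rewrite mulr0n -subr_eq0 -mulrBl mulf_eq0 subr_eq0 (inj_eq dinj) eq_sym.
by rewrite (negbTE ij) => /eqP.
Qed.

(** Each diagonal entry is a root of (x - a)(x - b), and the trace condition becomes (a - b)(#|S| -
    r) = 0, which fixes #|S| in characteristic 0. *)
Lemma diag_Gr (F : numFieldType) s r (a b : F) (e : 'rV[F]_s) :
  a != b -> (r <= s)%N -> Gr a b r s (diag_mx e) ->
  exists2 S : {set 'I_s}, #|S| = r & diag_mx e = two_valued a b S.
Proof.
move=> ab rs [_ eab etr]; pose S := [set i | e 0 i == a]%SET.
have eE : diag_mx e = two_valued a b S.
  congr diag_mx; apply/rowP => i; rewrite mxE inE; case: eqP => // ea.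
  have := congr1 (fun M : 'M[F]_s => M i i) eab.
  rewrite -!diag_const_mx -!linearB /= mulmx_diag !mxE eqxx mulr1n => /eqP.
  by rewrite mulf_eq0 !subr_eq0 => /orP[/eqP|/eqP].
exists S => //; move: etr; rewrite eE mxtrace_two_valued.
have Ss : (#|S| <= s)%N by rewrite -[X in (_ <= X)%N](card_ord s) max_card.
(* By [Ss] and [rs] neither natural-number subtraction truncates, so both become subtractions in
   F. *)
rewrite (mulrnBr _ Ss) (mulrnBr _ rs) -!(mulr_natr a) -!(mulr_natr b) => h; apply/eqP.
rewrite -(eqr_nat F) -(inj_eq (mulfI (_ : a - b != 0))) ?subr_eq0 //.
rewrite -subr_eq0; apply/eqP.
rewrite -[RHS](subrr (a * r%:R + (b * s%:R - b * r%:R))) -{1}h.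
by ring.
Qed.

(** Conjugation by V preserves [Gr] and reduces the claim to matrices commuting with a diagonal
    matrix of simple spectrum. *)
Lemma commuting_Gr (F : numFieldType) s r (a b : F) (V X : 'M[F]_s)
  (d : 'rV[F]_s) :
  a != b -> (r <= s)%N -> V^T *m V = 1%:M -> injective (d 0) ->
  let B := V *m diag_mx d *m V^T in
  (Gr a b r s X /\ X *m B = B *m X) <->
  exists2 S : {set 'I_s}, #|S| = r & X = V *m two_valued a b S *m V^T.
Proof.
move=> ab rs VV dinj /=; have VV' := mulmx1C VV.
have VK Y : V *m (V^T *m Y *m V) *m V^T = Y.
  by rewrite !mulmxA VV' mul1mx -mulmxA VV' mulmx1.
have mulV Y Y' : V *m Y *m V^T *m (V *m Y' *m V^T) = V *m (Y *m Y') *m V^T.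
  by rewrite -!mulmxA (mulmxA V^T) VV mul1mx.
split=> [[GX XB] | [S cS ->]]; last first.
  split; first by apply: Gr_conj => //; rewrite -cS; exact: Gr_two_valued.
  by rewrite !mulV /two_valued !mulmx_diag; congr (_ *m diag_mx _ *m _);
     apply/rowP => i; rewrite !mxE mulrC.
pose D := V^T *m X *m V.
have XE : X = V *m D *m V^T by rewrite VK.
have GD : Gr a b r s D.
  by rewrite /D -{2}(trmxK V); apply: Gr_conj => //; rewrite trmxK.
have DE : D = diag_mx (\row_i D i i).
  apply: (commuting_diag_mx dinj); move: XB; rewrite XE !mulV => h.
  have := congr1 (fun M => V^T *m M *m V) h.
  by rewrite !mulmxA VV !mul1mx -!(mulmxA _ V^T) VV !mulmx1.
rewrite DE in GD; have [S cS SE] := diag_Gr ab rs GD.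
by exists S => //; rewrite XE DE SE.
Qed.

(** Every eigenvalue occurs among the s entries of [d]. As s distinct values must fit there, no
    entry repeats. *)
Lemma eigenvalues_diag_inj (F : fieldType) s (V : 'M[F]_s) (d : 'rV[F]_s) :
  V^T *m V = 1%:M -> distinct_eigenvalues (V *m diag_mx d *m V^T) ->
  injective (d 0).
Proof.
move=> VV [t [ut /allP evt]]; have VV' := mulmx1C VV.
apply/injectiveP; apply: (leq_size_uniq ut); last first.
  by rewrite size_codom card_ord size_tuple.
move=> x /evt /eigenvalueP[v vB v0].
have w0 : v *m V != 0.
  by apply: contraNneq v0 => w0; rewrite -[v]mulmx1 -VV' mulmxA w0 mul0mx.
have wB : v *m V *m diag_mx d = x *: (v *m V).
  have := congr1 (mulmxr V) vB.
  by rewrite /= !mulmxA -(mulmxA _ V^T) VV mulmx1 -scalemxAl.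
move: (v *m V) w0 wB => w w0 /rowP wB.
have [j wj] : exists j, w 0 j != 0.
  apply/existsP; apply: contraNT w0 => /existsPn w0.
  by apply/eqP/rowP => j; rewrite [RHS]mxE; apply/eqP; have := w0 j; rewrite negbK.
have := wB j; rewrite mul_mx_diag !mxE mulrC => h.
by rewrite -(mulIf wj h); exact: codom_f.
Qed.

(** * Counting, block inclusions and permutation matrices *)

Lemma card_eq_image_finset (I : finType) (T : choiceType) (f : I -> T)
  (P : {set I}) : injective f -> f @` [set` P] #= `I_(#|P|).
Proof.
move=> finj.
have -> : f @` [set` P] = [set` [fset f x | x in P]%fset].
  apply/seteqP; split=> y /=.
    by move=> [x xP <-]; apply/imfsetP; exists x.
  by move=> /imfsetP[x xP ->]; exists x.
by apply/card_eq_fsetP; rewrite card_imfset // -cardE.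
Qed.

(** The inclusion J of the last q coordinates, with height cast along [e]; destructing [e] removes
    the cast in the lemmas below. *)
Definition last_block (F : fieldType) p q n (e : (p + q)%N = n) : 'M[F]_(n, q) :=
  castmx (e, erefl) (col_mx 0 1%:M).

Lemma last_block_orthogonal (F : fieldType) p q n (e : (p + q)%N = n) :
  (last_block F e)^T *m last_block F e = 1%:M.
Proof.
case: n / e; rewrite /last_block castmx_id tr_col_mx mul_row_col.
by rewrite mulmx0 add0r trmx1 mulmx1.
Qed.

Lemma last_block_cast0 (F : fieldType) p q n (e : (p + q)%N = n)
  (U : 'M[F]_p) : (last_block F e)^T *m castmx (e, e) (block_mx U 0 0 0) = 0.
Proof.
case: n / e; rewrite /last_block !castmx_id tr_col_mx mul_row_block.
by rewrite trmx0 mul0mx !mulmx0 !addr0 row_mx0.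
Qed.

Lemma last_block_sub (F : fieldType) p q n (e : (p + q)%N = n)
  (M : 'M[F]_(p + q)) :
  (last_block F e)^T *m castmx (e, e) M *m last_block F e = drsubmx M.
Proof.
case: n / e; rewrite /last_block !castmx_id tr_col_mx -{1}(submxK M).
rewrite mul_row_block mul_row_col.
by rewrite trmx0 trmx1 !mul0mx !mul1mx mulmx0 mulmx1 !add0r.
Qed.

Lemma last_block_split (F : fieldType) p q n (e : (p + q)%N = n)
  (U : 'M[F]_p) (X : 'M[F]_q) :
  castmx (e, e) (block_mx U 0 0 X) = castmx (e, e) (block_mx U 0 0 0)
    + last_block F e *m X *m (last_block F e)^T.
Proof.
case: n / e; rewrite /last_block !castmx_id tr_col_mx mul_col_mx mul_col_row.
by rewrite !trmx0 trmx1 !mul0mx mul1mx !mulmx0 mulmx1 add_block_mx !add0r addr0.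
Qed.

Lemma castmx_mul (F : fieldType) p n (e : p = n) (M N : 'M[F]_p) :
  castmx (e, e) M *m castmx (e, e) N = castmx (e, e) (M *m N).
Proof. by case: n / e; rewrite !castmx_id. Qed.

Lemma cast_block_two_valued (F : fieldType) p q s (e : (p + q)%N = s)
  (a b : F) :
  castmx (e, e) (block_mx (a%:M : 'M[F]_p) 0 0 (b%:M : 'M[F]_q)) =
  two_valued a b [set i : 'I_s | (i < p)%N]%SET.
Proof.
case: s / e; rewrite castmx_id -!diag_const_mx -diag_mx_row.
congr diag_mx; apply/rowP => i; rewrite !mxE.
case: splitP => j ij; rewrite mxE inE ij ?ltn_ord //.
by rewrite ltnNge leq_addr.
Qed.

(** A preimage appears because the (i, i) entry of the conjugate is the (tau i, tau i) entry of the
    original. *)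
Lemma perm_conj_two_valued (F : fieldType) s (a b : F) (S : {set 'I_s})
  (tau : 'S_s) :
  perm_mx tau *m two_valued a b S *m (perm_mx tau)^T =
  two_valued a b (tau @^-1: S).
Proof.
rewrite tr_perm_mx -row_permE -col_permE; apply/matrixP => i j.
by rewrite !mxE (inj_eq perm_inj) inE.
Qed.

Lemma card_ord_lt s r : (r <= s)%N -> #|[set i : 'I_s | (i < r)%N]%SET| = r.
Proof.
move=> rs; rewrite -sum1_card; under eq_bigl => i do rewrite inE.
by rewrite (big_ord_narrow rs) sum1_card card_ord.
Qed.

Lemma exists_perm_lt s (S : {set 'I_s}) :
  exists tau : 'S_s, S = tau @^-1: [set i : 'I_s | (i < #|S|)%N]%SET.
Proof.
(* List S first, then its complement; tau sends i to its position in this list. *)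
pose t := enum S ++ enum (~: S).
have tS i : i \in t by rewrite mem_cat !mem_enum inE orbN.
have szt : size t = s.
  by rewrite size_cat -!cardE cardsC card_ord.
have lt_t i : (index i t < s)%N by have := tS i; rewrite -index_mem szt.
have inj_t : injective (fun i => Ordinal (lt_t i)).
  by move=> i j [] ij; rewrite -(nth_index i (tS i)) ij nth_index.
exists (perm inj_t); apply/setP => i; rewrite !inE permE /= index_cat.
rewrite mem_enum; case: ifP => iS; first by rewrite cardE index_mem mem_enum.
by rewrite cardE ltnNge leq_addr.
Qed.

(** * Stationary points of [Omega] over a numeric field *)

Section Omega.
Variables (F : numFieldType) (k l m n : nat).
Variables (hkl : (k <= l)%N) (hlm : (l <= m)%N) (hmn : (m <= n)%N).
Let e := sum_blocks hkl hlm hmn.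

Definition Omega_point (a b : F) (Q : 'M[F]_n) (V : 'M[F]_(m - k))
    (S : {set 'I_(m - k)}) : 'M[F]_n :=
  Q *m block_abX hkl hlm hmn a b (V *m two_valued a b S *m V^T) *m Q^T.

(** Putting 0 for X isolates the constant part c of the affine form; 0 itself need not lie in
    [Gr]. *)
Lemma block_abXE (a b : F) (Q : 'M[F]_n) (X : 'M[F]_(m - k)) :
  let G := Q *m last_block F e in
  Q *m block_abX hkl hlm hmn a b X *m Q^T =
  Q *m block_abX hkl hlm hmn a b 0 *m Q^T + G *m X *m G^T.
Proof.
rewrite /block_abX /of_blocks /= last_block_split mulmxDr mulmxDl.
by rewrite trmx_mul !mulmxA.
Qed.

Lemma OmegaE (a b : F) (Q : 'M[F]_n) :
  Omega hkl hlm hmn a b Q =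
  affine_Gr a b (l - k) (Q *m block_abX hkl hlm hmn a b 0 *m Q^T)
    (Q *m last_block F e).
Proof.
by apply/seteqP; split=> _ [X GX <-]; exists X; rewrite // (block_abXE _ _ _ X).
Qed.

Variables (a b : F) (Q : 'M[F]_n) (V : 'M[F]_(m - k)).
Hypotheses (orthQ : Q^T *m Q = 1%:M) (orthV : V^T *m V = 1%:M).

Let G := Q *m last_block F e.

Let orthG : G^T *m G = 1%:M.
Proof.
by rewrite trmx_mul -mulmxA (mulmxA Q^T) orthQ mul1mx last_block_orthogonal.
Qed.

Hypothesis ab : a != b.

(** Compressing by [G] and then by [V] recovers the diagonal matrix, which determines the subset. *)
Lemma Omega_point_inj : injective (Omega_point a b Q V).
Proof.
move=> S T; rewrite /Omega_point !(block_abXE a b Q (_ *m _)) => /addrI h.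
apply: (two_valued_inj ab).
have {h} := congr1 (fun M => V^T *m (G^T *m M *m G) *m V) h.
by rewrite !(orthogonal_conjK _ orthG) !(orthogonal_conjK _ orthV).
Qed.

Lemma Omega_stationary (A : 'M[F]_n) (d : 'rV[F]_(m - k)) :
  A^T = A -> injective (d 0) -> G^T *m A *m G = V *m diag_mx d *m V^T ->
  dist_stationary (Omega hkl hlm hmn a b Q) A =
  Omega_point a b Q V @` [set S : {set 'I_(m - k)} | #|S| = (l - k)%N].
Proof.
move=> AT dinj AE.
have rs : (l - k <= m - k)%N by rewrite leq_sub2r.
have Gc : G^T *m (Q *m block_abX hkl hlm hmn a b 0 *m Q^T) = 0.
  rewrite trmx_mul !mulmxA -(mulmxA _ Q^T Q) orthQ mulmx1.
  by rewrite last_block_cast0 mul0mx.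
have st X (GX : Gr a b (l - k) (m - k) X) :=
  affine_Gr_stationary ab orthG Gc AT GX.
have cG X := commuting_Gr X ab rs orthV dinj.
rewrite OmegaE; apply/seteqP; split=> [Y [[X GX <-] Yst] | _ [S cS <-]].
  have /cG[S cS XE] : Gr a b (l - k) (m - k) X /\
      X *m (V *m diag_mx d *m V^T) = V *m diag_mx d *m V^T *m X.
    by split=> //; rewrite -AE; apply/(st X GX); split=> //; exists X.
  by exists S => //; rewrite /Omega_point (block_abXE _ _ _ (_ *m _)) XE.
have [GX XB] : Gr a b (l - k) (m - k) (V *m two_valued a b S *m V^T) /\
    V *m two_valued a b S *m V^T *m (V *m diag_mx d *m V^T) =
    V *m diag_mx d *m V^T *m (V *m two_valued a b S *m V^T).
  by apply/cG; exists S.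
by rewrite /Omega_point (block_abXE _ _ _ (_ *m _)); apply/(st _ GX); rewrite AE.
Qed.

Lemma card_Omega_points :
  Omega_point a b Q V @` [set S : {set 'I_(m - k)} | #|S| = (l - k)%N] #= `I_('C(m - k, l - k)).
Proof.
have <- : #|[set S : {set 'I_(m - k)} | #|S| == (l - k)%N]%SET| =
    'C(m - k, l - k).
  by rewrite card_draws card_ord.
have -> : [set S : {set 'I_(m - k)} | #|S| = (l - k)%N] =
    [set` [set S : {set 'I_(m - k)} | #|S| == (l - k)%N]%SET].
  by apply/seteqP; split=> S /=; rewrite inE => /eqP.
exact: card_eq_image_finset Omega_point_inj.
Qed.

(** Translates the permutation formula into subsets: the diagonal block has [a] in the first l - k
    positions, and conjugation by the permutation pulls this set back. *)
Lemma Omega_point_perm (tau : 'S_(m - k)) :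
  Q *m block_1X hkl hlm hmn (V *m perm_mx tau)
    *m block_abX hkl hlm hmn a b (block_ab hkl hlm a b)
    *m block_1X hkl hlm hmn ((perm_mx tau)^T *m V^T) *m Q^T =
  Omega_point a b Q V (tau @^-1: [set i : 'I_(m - k) | (i < l - k)%N]%SET).
Proof.
rewrite /Omega_point -perm_conj_two_valued /block_ab cast_block_two_valued.
rewrite -!(mulmxA Q); congr (Q *m (_ *m _)).
rewrite /block_1X /block_abX /of_blocks !castmx_mul; congr castmx.
rewrite !mulmx_block !(mul0mx, mulmx0, mul1mx, mulmx1, addr0, add0r).
by rewrite !mulmxA.
Qed.

End Omega.

(** * Passage from R to R[i] *)

Lemma cplxmx_two_valued (R : realType) (a b : R) s (S : {set 'I_s}) :
  cplxmx (two_valued a b S) = two_valued (cplx a) (cplx b) S.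
Proof.
rewrite /cplxmx /two_valued (map_diag_mx (real_complex R)); congr diag_mx.
by apply/rowP => i; rewrite !mxE; case: ifP.
Qed.

Lemma map_mx_last_block (F K : fieldType) (f : {rmorphism F -> K}) p q n
  (e : (p + q)%N = n) : map_mx f (last_block F e) = last_block K e.
Proof.
case: n / e; rewrite /last_block !castmx_id map_col_mx map_mx1.
by rewrite raddf0.
Qed.

Lemma map_mx_block_abX (F K : fieldType) (f : {rmorphism F -> K}) k l m n
  (hkl : (k <= l)%N) (hlm : (l <= m)%N) (hmn : (m <= n)%N) (a b : F)
  (X : 'M[F]_(m - k)) :
  map_mx f (block_abX hkl hlm hmn a b X) =
  block_abX hkl hlm hmn (f a) (f b) (map_mx f X).
Proof.
rewrite /block_abX /of_blocks map_castmx !map_block_mx !map_scalar_mx.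
by rewrite !raddf0.
Qed.

(** The point is built from real data by ring operations and transposes, all of which commute with
    the embedding. This is why the complex stationary points are real. *)
Lemma cplxmx_Omega_point (R : realType) k l m n (hkl : (k <= l)%N)
  (hlm : (l <= m)%N) (hmn : (m <= n)%N) (a b : R) (Q : 'M[R]_n)
  (V : 'M[R]_(m - k)) (S : {set 'I_(m - k)}) :
  cplxmx (Omega_point hkl hlm hmn a b Q V S) =
  Omega_point hkl hlm hmn (cplx a) (cplx b) (cplxmx Q) (cplxmx V) S.
Proof.
rewrite /Omega_point -cplxmx_two_valued /cplxmx.
rewrite -[@cplx R]/(real_complex R : R -> R[i]) !map_mxM map_trmx.
by rewrite map_mx_block_abX !map_mxM map_trmx.
Qed.

Theorem proposition4p6 (R : realType) (k l m n : nat)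
  (hk : (0 < k)%N) (hkl : (k <= l)%N) (hlm : (l <= m)%N) (hmn : (m <= n)%N)
  (a b : R) (hab : a != b)
  (U W : {vspace 'cV[R]_n})
  (dimU : \dim U = k) (dimW : \dim W = m) (UW : (U <= W)%VS)
  (Q : 'M[R]_n) (orthQ : orthogonalmx Q)
  (QU : colspan Q 0 k = U)
  (QW : [set` colspan Q k (k + (n - m))%N] = orthcompl W)
  (A : 'M[R]_n) (symA : A^T = A)
  (B11 : 'M[R]_k) (B12 : 'M[R]_(k, n - m)) (B13 : 'M[R]_(k, m - k))
  (B22 : 'M[R]_(n - m)) (B23 : 'M[R]_(n - m, m - k)) (B33 : 'M[R]_(m - k))
  (blocksA : Q^T *m A *m Q =
     of_blocks hkl hlm hmn
       (block_mx (block_mx B11 B12 B12^T B22) (col_mx B13 B23)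
                 (row_mx B13^T B23^T)         B33))
  (eigB33 : distinct_eigenvalues B33)
  (V Lam : 'M[R]_(m - k)) (orthV : orthogonalmx V) (diagLam : is_diag_mx Lam)
  (evdB33 : B33 = V *m Lam *m V^T) :
  [/\ forall Y : 'M[R]_n,
        dist_stationary (Omega hkl hlm hmn a b Q) A Y <->
        exists tau : 'S_(m - k),
          Y = Q *m block_1X hkl hlm hmn (V *m perm_mx tau)
                *m block_abX hkl hlm hmn a b (block_ab hkl hlm a b)
                *m block_1X hkl hlm hmn ((perm_mx tau)^T *m V^T) *m Q^T,
      dist_stationary
        (Omega hkl hlm hmn (cplx a) (cplx b) (cplxmx Q)) (cplxmx A)
        #= `I_('C(m - k, l - k))
    & dist_stationary
        (Omega hkl hlm hmn (cplx a) (cplx b) (cplxmx Q)) (cplxmx A)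
        `<=` [set cplxmx Y | Y in Omega hkl hlm hmn a b Q]].
Proof.
set e := sum_blocks hkl hlm hmn.
pose d : 'rV[R]_(m - k) := \row_i Lam i i.
have LamE : Lam = diag_mx d.
  apply/matrixP => i j; rewrite !mxE; have [<-|ij] := eqVneq i j.
    by rewrite mulr1n.
  by rewrite mulr0n; move/is_diag_mxP: diagLam; apply.
rewrite LamE in evdB33.
have dinj : injective (d 0).
  by apply: (eigenvalues_diag_inj orthV); rewrite -evdB33.
(* The compression of A by Q J is the last diagonal block B33 of Q^T A Q. *)
have AE : (Q *m last_block R e)^T *m A *m (Q *m last_block R e) =
    V *m diag_mx d *m V^T.
  rewrite trmx_mul -evdB33 -!mulmxA (mulmxA A) (mulmxA Q^T).
  by rewrite (mulmxA Q^T A) blocksA mulmxA last_block_sub block_mxKdr.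
have cinj : injective (real_complex R) by exact: fmorph_inj.
(* This exposes the ring-morphism structure of [cplx] to the [map_mx] lemmas. *)
have cE : @cplx R = real_complex R by [].
have orthQC : (cplxmx Q)^T *m cplxmx Q = 1%:M.
  by rewrite /cplxmx cE map_trmx -map_mxM orthQ map_mx1.
have orthVC : (cplxmx V)^T *m cplxmx V = 1%:M.
  by rewrite /cplxmx cE map_trmx -map_mxM orthV map_mx1.
have abC : cplx a != cplx b by rewrite cE (inj_eq cinj).
have symAC : (cplxmx A)^T = cplxmx A by rewrite /cplxmx map_trmx symA.
(* The spectrum stays simple over R[i] because the embedding is injective. *)
have dinjC : injective (map_mx (real_complex R) d 0).
  by move=> i j; rewrite !mxE => /cinj; have := dinj i j; rewrite !mxE; apply.
have AEC : (cplxmx Q *m last_block R[i] e)^T *m cplxmx A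
      *m (cplxmx Q *m last_block R[i] e) =
    cplxmx V *m diag_mx (map_mx (real_complex R) d) *m (cplxmx V)^T.
  rewrite /cplxmx cE -(map_mx_last_block (real_complex R)) -map_diag_mx.
  by rewrite -!map_mxM !map_trmx -!map_mxM AE.
have rs : (l - k <= m - k)%N by rewrite leq_sub2r.
have stR := Omega_stationary orthQ orthV hab symA dinj AE.
have stC := Omega_stationary orthQC orthVC abC symAC dinjC AEC.
split.
(* Every subset of size l - k is the preimage of the first l - k indices under some tau, and
   conversely such preimages have size l - k. *)
- move=> Y; rewrite stR; split=> [[S cS <-] | [tau ->]].
    have [tau SE] := exists_perm_lt S; exists tau.
    by rewrite Omega_point_perm -cS -SE.
  rewrite Omega_point_perm; eexists; last by [].
  by rewrite /= (card_preimset _ (@perm_inj _ tau)) card_ord_lt.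
- by rewrite stC; exact: card_Omega_points.
- rewrite stC => _ [S cS <-]; exists (Omega_point hkl hlm hmn a b Q V S).
    exists (V *m two_valued a b S *m V^T) => //.
    by apply: Gr_conj => //; rewrite -cS; exact: Gr_two_valued.
  exact: cplxmx_Omega_point.
Qed.
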